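(* Let $r\in\mathbf C\setminus\{0\}$ and $s=\varepsilon\,\mathrm{i}\,q^{m+1/2}$, where $m\in\mathbf Z$ and $\varepsilon\in\{1,-1\}$. Then the representation $R_{rs}$ of $U_q({\rm iso}_2)$ is reducible.
   Context: $q$ is a nonzero complex number which is not a root of unity, with a fixed square root $q^{1/2}$; $\mathrm{i}=\sqrt{-1}$. $U_q({\rm iso}_2)$ is the complex associative algebra with unit generated by $I,T_1,T_2$ subject to $$q^{1/2}IT_2-q^{-1/2}T_2I=T_1,\qquad q^{1/2}T_1I-q^{-1/2}IT_1=T_2,\qquad q^{1/2}T_2T_1-q^{-1/2}T_1T_2=0.$$ Let $\mathcal H$ be the Hilbert space with orthonormal basis $|n\rangle$, $n\in\mathbf Z$, and $\mathcal D={\rm lin}\{|n\rangle: n\in\mathbf Z\}$ (finite linear combinations). For $r,s\in\mathbf C\setminus\{0\}$ with $s\neq\pm\mathrm{i}q^k$ for all $k\in\mathbf Z$, $R_{rs}$ is the representation of $U_q({\rm iso}_2)$ on $\mathcal D$ given by $$R_{rs}(I)|n\rangle=\mathrm{i}\,\frac{sq^n-s^{-1}q^{-n}}{q-q^{-1}}\,|n\rangle,\qquad R_{rs}(T_2)|n\rangle=\frac{r}{sq^n+s^{-1}q^{-n}}\big\{|n+1\rangle+|n-1\rangle\big\},$$ $$R_{rs}(T_1)|n\rangle=\frac{\mathrm{i}q^{1/2}r}{sq^n+s^{-1}q^{-n}}\big\{sq^n|n+1\rangle-s^{-1}q^{-n}|n-1\rangle\big\}.$$ Reducible means that there is a linear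 subspace of $\mathcal D$, different from $0$ and $\mathcal D$, invariant under all operators of the representation. *)

(* Defs.v *)
From HB Require Import structures.
From mathcomp Require Import all_boot all_order all_algebra.
From mathcomp Require Import generic_quotient ring_quotient.
From mathcomp Require Import ring zify.
From mathcomp Require Import finmap.
From mathcomp Require Import boolp reals.
From mathcomp Require Import complex.
From mathcomp.multinomials Require Import monalg.

Set Implicit Arguments.
Unset Strict Implicit.
Unset Printing Implicit Defensive.

Import Order.TTheory GRing.Theory Num.Theory.
Local Open Scope ring_scope.

Section LinearExtension.
Variables (K : nzRingType) (T : choiceType) (V : lmodType K) (f : T -> V).
Implicit Types g : {malg K[T]}.

(* The linear map sending the basis vector << t >> of {malg K[T]} to f t. *)
Definition lin_ext g : V := \sum_(t <- msupp g) g@_t *: f t.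

Lemma lin_extEw (d : {fset T}) g : (msupp g `<=` d)%fset ->
  lin_ext g = \sum_(t <- d) g@_t *: f t.
Proof.
move=> le; rewrite /lin_ext.
rewrite [RHS](big_fsetID _ (fun t => t \in msupp g)) /=.
rewrite [X in _ = _ + X]big1_fset ?addr0; last first.
  by move=> t; rewrite !inE /= => /andP[_ tg] _; rewrite mcoeff_outdom ?scale0r.
apply: eq_fbigl => t; rewrite !inE /=.
by case tg: (t \in msupp g); rewrite ?andbF ?andbT // (fsubsetP le).
Qed.

Lemma lin_ext_is_linear : linear lin_ext.
Proof.
move=> a g h.
set d := (msupp (a *: g + h) `|` (msupp g `|` msupp h))%fset.
rewrite (@lin_extEw d (a *: g + h)) ?fsubsetUl //.
rewrite (@lin_extEw d g); last by rewrite /d fsetUCA fsubsetUl.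
rewrite (@lin_extEw d h); last by rewrite /d fsetUA fsubsetUr.
rewrite scaler_sumr -big_split /=; apply: eq_bigr => t _.
by rewrite mcoeffD mcoeffZ scalerDl scalerA.
Qed.

HB.instance Definition _ :=
  GRing.isLinear.Build K {malg K[T]} V *:%R lin_ext lin_ext_is_linear.

Lemma lin_extU c t : lin_ext << c *g t >> = c *: f t.
Proof.
by rewrite (@lin_extEw [fset t]%fset) ?msuppU_le // big_seq_fset1 mcoeffUU.
Qed.

End LinearExtension.

Section MonoidAlgebra.
Variables (C : comNzRingType) (M : monomType).

Lemma malg_scaleU k c (w : M) : k *: << c *g w >> = << k * c *g w >> :> {malg C[M]}.
Proof. by apply/malgP => w'; rewrite mcoeffZ !mcoeffU mulrnAr. Qed.

Lemma malg_scalerAr (k : C) (x y : {malg C[M]}) : k *: (x * y) = x * (k *: y).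
Proof.
rewrite (monalgE x) mulr_suml scaler_sumr mulr_suml; apply: eq_bigr => i _.
rewrite (monalgE y) mulr_sumr !scaler_sumr mulr_sumr; apply: eq_bigr => j _.
by rewrite malgM_def fgmulUU malg_scaleU [in RHS]malg_scaleU malgM_def fgmulUU mulrCA.
Qed.

End MonoidAlgebra.

Section QuotientAlgebra.
Variables (C : fieldType) (A : algType C).

Definition two_sided_ideal (J : {pred A}) : Prop :=
  zmod_closed J /\ forall a x b, x \in J -> a * x * b \in J.

Variable rels : seq A.

(* the smallest two-sided ideal containing rels *)
Definition gen_ideal : {pred A} := fun x =>
  `[< forall J : {pred A},
        two_sided_ideal J -> {subset rels <= J} -> x \in J >].

Lemma gen_idealP x : reflect (forall J : {pred A},
  two_sided_ideal J -> {subset rels <= J} -> x \in J) (x \in gen_ideal).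
Proof. exact: asboolP. Qed.

Lemma gen_ideal_zmod_closed : zmod_closed gen_ideal.
Proof.
split=> [|x y /gen_idealP xJ /gen_idealP yJ]; apply/gen_idealP => J HJ sJ.
  by case: HJ => -[].
by case: (HJ) => -[_ JB] _; apply: JB; [apply: xJ | apply: yJ].
Qed.

HB.instance Definition _ :=
  GRing.isZmodClosed.Build A gen_ideal gen_ideal_zmod_closed.

Lemma gen_idealM a x b : x \in gen_ideal -> a * x * b \in gen_ideal.
Proof.
move=> /gen_idealP xJ; apply/gen_idealP => J HJ sJ.
by case: (HJ) => _; apply; apply: xJ.
Qed.

Lemma gen_idealMl a x : x \in gen_ideal -> a * x \in gen_ideal.
Proof. by rewrite -[a * x]mulr1; apply: gen_idealM. Qed.

Lemma gen_idealMr x b : x \in gen_ideal -> x * b \in gen_ideal.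
Proof. by rewrite -[x in x * b]mul1r; apply: gen_idealM. Qed.

Lemma gen_idealZ c x : x \in gen_ideal -> c *: x \in gen_ideal.
Proof. by rewrite -[x in c *: x]mul1r scalerAl; apply: gen_idealMl. Qed.

Lemma gen_ideal_rels x : x \in rels -> x \in gen_ideal.
Proof. by move=> xr; apply/gen_idealP => J _; apply. Qed.

Hypothesis rels_proper : 1 \notin gen_ideal.

(* The argument rels_proper ensures that the quotient is a nonzero ring. *)
Definition quot_alg of 1 \notin gen_ideal := Quotient.quot gen_ideal.

Local Notation Q := (quot_alg rels_proper).
HB.instance Definition _ := GRing.Zmodule.on Q.

Definition qpi (x : A) : Q := (\pi_(Quotient.quot gen_ideal) x)%qT.
Definition qrepr (u : Q) : A := repr (u : Quotient.quot gen_ideal).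

Lemma qpiP x y : reflect (qpi x = qpi y) (x - y \in gen_ideal).
Proof. by rewrite Quotient.idealrBE; apply: eqP. Qed.

Lemma qreprK (u : Q) : qpi (qrepr u) = u.
Proof. exact: reprK. Qed.

Lemma qpiD x y : qpi (x + y) = qpi x + qpi y.
Proof. exact: Quotient.pi_add. Qed.

Lemma qpiB x y : qpi (x - y) = qpi x - qpi y.
Proof. by rewrite qpiD; congr (_ + _); apply: Quotient.pi_opp. Qed.

Definition qone : Q := qpi 1.
Definition qmul (u v : Q) : Q := qpi (qrepr u * qrepr v).
Definition qscale (c : C) (u : Q) : Q := qpi (c *: qrepr u).

Lemma qmul_pi x y : qmul (qpi x) (qpi y) = qpi (x * y).
Proof.
apply/qpiP; set x' := qrepr _; set y' := qrepr _.
have -> : x' * y' - x * y = x' * (y' - y) + (x' - x) * y.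
  by rewrite mulrBr mulrBl addrA subrK.
apply: rpredD; [apply: gen_idealMl | apply: gen_idealMr];
  by apply/qpiP; rewrite qreprK.
Qed.

Lemma qscale_pi c x : qscale c (qpi x) = qpi (c *: x).
Proof.
apply/qpiP; rewrite -scalerBr; apply: gen_idealZ.
by apply/qpiP; rewrite qreprK.
Qed.

Lemma quot_ind (P : Q -> Prop) : (forall x, P (qpi x)) -> forall u, P u.
Proof. by move=> H u; rewrite -[u]qreprK. Qed.

Fact qmulA : associative qmul.
Proof.
elim/quot_ind=> x; elim/quot_ind=> y; elim/quot_ind=> z.
by rewrite !qmul_pi mulrA.
Qed.

Fact qmul1 : left_id qone qmul.
Proof. by elim/quot_ind=> x; rewrite qmul_pi mul1r. Qed.

Fact qmulr1 : right_id qone qmul.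
Proof. by elim/quot_ind=> x; rewrite qmul_pi mulr1. Qed.

Fact qmulDl : left_distributive qmul +%R.
Proof.
elim/quot_ind=> x; elim/quot_ind=> y; elim/quot_ind=> z.
by rewrite -qpiD !qmul_pi mulrDl qpiD.
Qed.

Fact qmulDr : right_distributive qmul +%R.
Proof.
elim/quot_ind=> x; elim/quot_ind=> y; elim/quot_ind=> z.
by rewrite -qpiD !qmul_pi mulrDr qpiD.
Qed.

Fact qone_neq0 : qone != 0.
Proof.
apply/eqP => H; have /qpiP : qpi 1 = qpi 0.
  by rewrite -[in RHS](subrr 1) qpiB subrr.
by rewrite subr0; apply/negP/rels_proper.
Qed.

HB.instance Definition _ := GRing.Zmodule_isNzRing.Build Q
  qmulA qmul1 qmulr1 qmulDl qmulDr qone_neq0.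

Fact qscaleA a b u : qscale a (qscale b u) = qscale (a * b) u.
Proof. by elim/quot_ind: u => x; rewrite !qscale_pi scalerA. Qed.

Fact qscale1 : left_id 1 qscale.
Proof. by elim/quot_ind=> x; rewrite qscale_pi scale1r. Qed.

Fact qscaleDr : right_distributive qscale +%R.
Proof.
move=> c; elim/quot_ind=> x; elim/quot_ind=> y.
by rewrite -qpiD !qscale_pi scalerDr qpiD.
Qed.

Fact qscaleDl u : {morph qscale^~ u : a b / a + b}.
Proof.
by elim/quot_ind: u => x a b; rewrite !qscale_pi scalerDl qpiD.
Qed.

HB.instance Definition _ := GRing.Zmodule_isLmodule.Build C Q
  qscaleA qscale1 qscaleDr qscaleDl.

Lemma qpi1 : qpi 1 = 1. Proof. by []. Qed.

Lemma qpiM x y : qpi (x * y) = qpi x * qpi y.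
Proof. by rewrite -qmul_pi. Qed.

Lemma qpiZ c x : qpi (c *: x) = c *: qpi x.
Proof. by rewrite -qscale_pi. Qed.

Fact qscaleAl (a : C) (u v : Q) : a *: (u * v) = (a *: u) * v.
Proof.
elim/quot_ind: u => x; elim/quot_ind: v => y.
by rewrite -(qpiM x y) -(qpiZ a x) -(qpiM _ y) -qpiZ scalerAl.
Qed.

HB.instance Definition _ := GRing.Lmodule_isLalgebra.Build C Q qscaleAl.

Fact qscaleAr (a : C) (u v : Q) : a *: (u * v) = u * (a *: v).
Proof.
elim/quot_ind: u => x; elim/quot_ind: v => y.
by rewrite -(qpiM x y) -(qpiZ a y) -(qpiM x) -qpiZ scalerAr.
Qed.

HB.instance Definition _ := GRing.Lalgebra_isAlgebra.Build C Q qscaleAr.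

End QuotientAlgebra.

Section Representations.
Variables (C : fieldType) (A : algType C) (V : lmodType C).

(* A unital algebra homomorphism from A to the linear endomorphisms of V. *)
Record representation := Representation {
  rep_op :> A -> {linear V -> V};
  rep1 : forall v, rep_op 1 v = v;
  repM : forall a b v, rep_op (a * b) v = rep_op a (rep_op b v);
  repP : forall c a b v, rep_op (c *: a + b) v = c *: rep_op a v + rep_op b v
}.

Definition reducible (rho : representation) : Prop :=
  exists W : {pred V},
    [/\ submod_closed W,
        exists2 v, v \in W & v != 0,
        exists v, v \notin W
      & forall a, {in W, forall v, rho a v \in W}].

End Representations.

Section QuotientRep.
Variables (C : fieldType) (A : algType C) (V : lmodType C).
Variable rho : representation A V.

Lemma rep0 v : rho 0 v = 0.
Proof.
by have := repP rho (-1) 0 0 v; rewrite scaler0 addr0 scaleN1r addNr.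
Qed.

Lemma repZ c a v : rho (c *: a) v = c *: rho a v.
Proof. by rewrite -[c *: a]addr0 repP rep0 addr0. Qed.

Lemma repB a b v : rho (a - b) v = rho a v - rho b v.
Proof.
have -> : a - b = -1 *: b + a by rewrite scaleN1r addrC.
by rewrite repP scaleN1r addrC.
Qed.

Variable rels : seq A.
Hypothesis rels_proper : 1 \notin gen_ideal rels.
Hypothesis rels0 : forall x, x \in rels -> forall v, rho x v = 0.

Lemma rep_ideal x v : x \in gen_ideal rels -> rho x v = 0.
Proof.
move=> /gen_idealP /(_ (fun x => `[< forall v, rho x v = 0 >])).
move=> H; suff /asboolP : (fun x => `[< forall v, rho x v = 0 >]) x by [].
apply: H; last by move=> y yr; apply/asboolP => u; apply: rels0.
split; first split.
- by apply/asboolP => u; exact: rep0.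
- move=> y z /asboolP y0 /asboolP z0; apply/asboolP => u.
  by rewrite repB y0 z0 subrr.
move=> a y b /asboolP y0; apply/asboolP => u.
by rewrite !repM y0 linear0.
Qed.

Definition quot_act (u : quot_alg rels_proper) : {linear V -> V} :=
  rho (qrepr u).

Lemma quot_act_pi x v : quot_act (qpi rels_proper x) v = rho x v.
Proof.
apply/subr0_eq; rewrite -repB; apply: rep_ideal.
by apply/(qpiP rels_proper); rewrite qreprK.
Qed.

Fact quot_act1 v : quot_act 1 v = v.
Proof. by rewrite -qpi1 quot_act_pi rep1. Qed.

Fact quot_actM a b v : quot_act (a * b) v = quot_act a (quot_act b v).
Proof.
elim/quot_ind: a => x; elim/quot_ind: b => y.
by rewrite -qpiM !quot_act_pi repM.
Qed.

Fact quot_actP c a b v :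
  quot_act (c *: a + b) v = c *: quot_act a v + quot_act b v.
Proof.
elim/quot_ind: a => x; elim/quot_ind: b => y.
by rewrite -qpiZ -qpiD !quot_act_pi repP.
Qed.

(* A representation of A killing rels factors through the quotient. *)
Definition quot_rep : representation (quot_alg rels_proper) V :=
  Representation quot_act1 quot_actM quot_actP.

End QuotientRep.

Section UqIso2.
Variable C : fieldType.

(* The three generators I, T_1, T_2. *)
Variant gen := genI | genT1 | genT2.

HB.instance Definition _ := gen_eqMixin gen.
HB.instance Definition _ := gen_choiceMixin gen.

(* The free associative unital algebra on the generators. *)
Definition free_alg := {malg C[{fmonom gen}]}.
HB.instance Definition _ := GRing.Lalgebra.on free_alg.
HB.instance Definition _ :=
  GRing.Lalgebra_isAlgebra.Build C free_alg (@malg_scalerAr _ _).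

Definition fgen (x : gen) : free_alg := << fmu x >>.

(* qh is the chosen square root of q; the three entries are the defining
   relations, left-hand side minus right-hand side. *)
Definition iso2_rels (A : algType C) (qh : C) (I T1 T2 : A) : seq A :=
  [:: qh *: (I * T2) - qh^-1 *: (T2 * I) - T1;
      qh *: (T1 * I) - qh^-1 *: (I * T1) - T2;
      qh *: (T2 * T1) - qh^-1 *: (T1 * T2)].

Lemma iso2_rels_proper (A : algType C) (qh : C) (I T1 T2 : A) (e : A -> C) :
  e 1 = 1 -> {morph e : x y / x - y} -> {morph e : x y / x * y} ->
  (forall c x, e (c *: x) = c * e x) -> e I = 0 -> e T1 = 0 -> e T2 = 0 ->
  1 \notin gen_ideal (iso2_rels qh I T1 T2).
Proof.
move=> e1 eB eM eZ eI eT1 eT2.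
have e0 : e 0 = 0 by rewrite -(subrr 1) eB subrr.
apply/negP => /gen_idealP /(_ (fun x => e x == 0)).
rewrite unfold_in e1 oner_eq0 => H; suff: false by []; apply: H.
  split; first split; rewrite ?unfold_in ?e0 //.
    by move=> x y; rewrite !unfold_in eB => /eqP-> /eqP->; rewrite subrr.
  by move=> a x b; rewrite !unfold_in !eM => /eqP ->; rewrite mulr0 mul0r.
move=> x; rewrite !inE unfold_in.
by case/or3P => /eqP ->; rewrite !eB !eZ !eM ?eI ?eT1 ?eT2 !mulr0 ?subr0.
Qed.

Variable qh : C.

Definition Uq_rels : seq free_alg :=
  iso2_rels qh (fgen genI) (fgen genT1) (fgen genT2).

Lemma Uq_rels_proper : 1 \notin gen_ideal Uq_rels.
Proof.
have eg x : mcoeff (@mone {fmonom gen}) (fgen x) = 0.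
  by rewrite /fgen mcoeffU1 fm1_eq1.
apply: (@iso2_rels_proper free_alg qh _ _ _
  (mcoeff (@mone {fmonom gen}) : free_alg -> C)) => //.
- exact: rmorph1.
- exact: rmorphB.
- exact: rmorphM.
by move=> c x; apply: mcoeffZ.
Qed.

(* U_q(iso_2): the free algebra modulo the defining relations. *)
Definition Uq : algType C := quot_alg Uq_rels_proper.

Definition Uq_gen (x : gen) : Uq := qpi Uq_rels_proper (fgen x).

Lemma Uq_relations :
  let I := Uq_gen genI in let T1 := Uq_gen genT1 in let T2 := Uq_gen genT2 in
  [/\ qh *: (I * T2) - qh^-1 *: (T2 * I) = T1,
      qh *: (T1 * I) - qh^-1 *: (I * T1) = T2
    & qh *: (T2 * T1) - qh^-1 *: (T1 * T2) = 0].
Proof.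
have H (A : algType C) (I T1 T2 : A)
    (p : 1 \notin gen_ideal (iso2_rels qh I T1 T2)) :
  [/\ qh *: (qpi p I * qpi p T2) - qh^-1 *: (qpi p T2 * qpi p I) = qpi p T1,
      qh *: (qpi p T1 * qpi p I) - qh^-1 *: (qpi p I * qpi p T1) = qpi p T2
    & qh *: (qpi p T2 * qpi p T1) - qh^-1 *: (qpi p T1 * qpi p T2) = 0].
  have E c x y z w : c *: (qpi p x * qpi p y) - qh^-1 *: (qpi p z * qpi p w)
      = qpi p (c *: (x * y) - qh^-1 *: (z * w)).
    by rewrite qpiB (qpiZ p c) (qpiZ p qh^-1) (qpiM p x) (qpiM p z).
  split; rewrite E.
  - by apply/qpiP/gen_ideal_rels; rewrite !inE eqxx.
  - by apply/qpiP/gen_ideal_rels; rewrite !inE eqxx orbT.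
  rewrite -(subrr (qpi p 0)) -qpiB; apply/qpiP.
  by rewrite subrr subr0; apply: gen_ideal_rels; rewrite !inE eqxx !orbT.
exact: H.
Qed.

End UqIso2.

Section FreeRep.
Variables (C : fieldType) (V : lmodType C) (op : gen -> {linear V -> V}).

Definition word_act (v : V) (w : {fmonom gen}) : V :=
  foldr (fun x => op x : V -> V) v w.

Definition free_act (a : free_alg C) (v : V) : V := lin_ext (word_act v) a.

Lemma word_act_linear w : linear (word_act^~ w).
Proof.
rewrite /word_act; case: w => w c u v /=; elim: w => //= x w ->.
by rewrite linearP.
Qed.

Lemma free_act_linear a : linear (free_act a).
Proof.
move=> c u v; rewrite /free_act /lin_ext scaler_sumr -big_split /=.
apply: eq_bigr => w _; rewrite word_act_linear scalerDr.
by rewrite !scalerA mulrC.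
Qed.

HB.instance Definition _ a :=
  GRing.isLinear.Build C V V *:%R (free_act a) (free_act_linear a).

Fact free_act1 v : free_act 1 v = v.
Proof.
rewrite -[1]/(<< 1 *g mone >> : {malg C[{fmonom gen}]}).
by rewrite /free_act (lin_extU (word_act v)) scale1r /word_act fm1.
Qed.

Lemma free_act_fgen x v : free_act (fgen C x) v = op x v.
Proof. by rewrite /free_act lin_extU scale1r /word_act fmU. Qed.

Fact free_actM a b v : free_act (a * b) v = free_act a (free_act b v).
Proof.
rewrite malgME /free_act raddf_sum /= {2}/lin_ext; apply: eq_bigr => w _.
rewrite raddf_sum /= [X in _ *: word_act X _]/lin_ext.
have wact_lin : linear (word_act^~ w) := word_act_linear w.
pose L : {linear V -> V} := HB.pack (word_act^~ w)
  (GRing.isLinear.Build C V V *:%R (word_act^~ w) wact_lin).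
rewrite -[word_act _ w]/(L _) linear_sum scaler_sumr.
apply: eq_bigr => w' _; rewrite lin_extU linearZ scalerA /=.
by rewrite /word_act fmM foldr_cat.
Qed.

Fact free_actP c a b v :
  free_act (c *: a + b) v = c *: free_act a v + free_act b v.
Proof. exact: (lin_ext_is_linear (word_act v)). Qed.

Definition free_rep : representation (free_alg C) V :=
  @Representation C (free_alg C) V (fun a => free_act a)
    free_act1 free_actM free_actP.

End FreeRep.

(* Operators satisfying the defining relations of U_q(iso_2) extend to a
   representation. *)
Section UqRep.
Variables (C : fieldType) (qh : C) (V : lmodType C) (op : gen -> {linear V -> V}).

Definition op_rels : Prop := let I := op genI in
  let T1 := op genT1 in let T2 := op genT2 in forall v,
  [/\ qh *: I (T2 v) - qh^-1 *: T2 (I v) = T1 v,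
      qh *: T1 (I v) - qh^-1 *: I (T1 v) = T2 v
    & qh *: T2 (T1 v) - qh^-1 *: T1 (T2 v) = 0].

Hypothesis opP : op_rels.

Lemma free_rep_rels x : x \in Uq_rels qh -> forall v, free_rep op x v = 0.
Proof.
have H (A : algType C) (rho : representation A V) (I T1 T2 : A) :
    (forall v, rho I v = op genI v) -> (forall v, rho T1 v = op genT1 v) ->
    (forall v, rho T2 v = op genT2 v) ->
    forall y, y \in iso2_rels qh I T1 T2 -> forall v, rho y v = 0.
  move=> rI r1 r2 y; rewrite !inE => yr v; have [e1 e2 e3] := opP v.
  case/or3P: yr => /eqP ->; rewrite !repB !repZ !repM !(rI, r1, r2).
  - by rewrite e1 subrr.
  - by rewrite e2 subrr.
  exact: e3.
by apply: H => v; apply: free_act_fgen.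
Qed.

Definition Uq_rep : representation (Uq qh) V :=
  quot_rep (Uq_rels_proper qh) free_rep_rels.

Lemma Uq_rep_gen x v : Uq_rep (Uq_gen qh x) v = op x v.
Proof. exact: etrans (quot_act_pi _ free_rep_rels _ _) (free_act_fgen op x v). Qed.

End UqRep.

Section LinearCombinations.
Variables (C : fieldType) (V : lmodType C).
Implicit Types (u w z : V) (a b c : C).

Lemma rel_linear (a b c : C)
    (f g h k e : {linear V -> V}) :
  linear (fun v => a *: f (g v) - b *: h (k v) - c *: e v).
Proof.
move=> x u v; rewrite !linearP.
by rewrite /= !scalerDr (AC ((2*2)*2) ((1*3*5)*(2*4*6))) ?scalerN; exact: erefl.
Qed.

Lemma combine1 u w a b c t t1 l lp lm x y :
  a * t * lp - b * l * t - c * t1 * x = 0 ->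
  a * t * lm - b * l * t + c * t1 * y = 0 ->
  a *: (t *: (lp *: u + lm *: w)) - b *: (l *: (t *: (u + w)))
    - c *: (t1 *: (x *: u - y *: w)) = 0.
Proof.
move=> e1 e2; transitivity
  ((a * t * lp - b * l * t - c * t1 * x) *: u +
   (a * t * lm - b * l * t + c * t1 * y) *: w).
  rewrite !(scalerDr, scalerN, scalerBr, scalerDl, scaleNr, scalerA) !opprD opprK.
  by rewrite ?mulrA (AC ((2*2)*2) ((1*3*5)*(2*4*6))).
by rewrite e1 e2 !scale0r addr0.
Qed.

Lemma combine2 u w a b c t t1 l lp lm x y :
  a * l * t1 * x - b * t1 * x * lp - c * t = 0 ->
  - (a * l * t1 * y) + b * t1 * y * lm - c * t = 0 ->
  a *: (l *: (t1 *: (x *: u - y *: w))) -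
   b *: (t1 *: (x *: (lp *: u) - y *: (lm *: w)))
    - c *: (t *: (u + w)) = 0.
Proof.
move=> e1 e2; transitivity
  ((a * l * t1 * x - b * t1 * x * lp - c * t) *: u +
   (- (a * l * t1 * y) + b * t1 * y * lm - c * t) *: w).
  rewrite !(scalerDr, scalerN, scalerBr, scalerDl, scaleNr, scalerA) !opprD opprK.
  by rewrite ?mulrA (AC ((2*2)*2) ((1*3*5)*(2*4*6))).
by rewrite e1 e2 !scale0r addr0.
Qed.

(* u = |n+2>, z = |n>, w = |n-2> *)
Lemma combine3 u z w a b t tp tm t1 t1p t1m x y xp yp xm ym :
  a * t1 * x * tp - b * t * t1p * xp = 0 ->
  a * t1 * x * tp - a * t1 * y * tm + b * t * t1p * yp - b * t * t1m * xm = 0 ->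
  - (a * t1 * y * tm) + b * t * t1m * ym = 0 ->
  a *: (t1 *: (x *: (tp *: (u + z)) - y *: (tm *: (z + w)))) -
   b *: (t *: (t1p *: (xp *: u - yp *: z) + t1m *: (xm *: z - ym *: w))) = 0.
Proof.
move=> e1 e2 e3; transitivity
  ((a * t1 * x * tp - b * t * t1p * xp) *: u +
   (a * t1 * x * tp - a * t1 * y * tm + b * t * t1p * yp - b * t * t1m * xm) *: z
   + (- (a * t1 * y * tm) + b * t * t1m * ym) *: w).
  rewrite !(scalerDr, scalerN, scalerBr, scalerDl, scaleNr, scalerA) !(opprD, opprK).
  by rewrite ?mulrA (AC ((2*2)*(2*2)) ((1*5)*(2*3*6*7)*(4*8))).
by rewrite e1 e2 e3 !scale0r !addr0.
Qed.

End LinearCombinations.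

Section Rrs.
Variable C : numClosedFieldType.
Implicit Types q qh r s : C.

(* q is nonzero and not a root of unity, and qh is a square root of q *)
Definition generic_q q qh : Prop :=
  [/\ q != 0, forall n : nat, (0 < n)%N -> q ^+ n != 1 & qh ^+ 2 = q].

Definition admissible q s : Prop :=
  s != 0 /\ forall k : int, s != 'i * q ^ k /\ s != - ('i * q ^ k).

(* The space of finite linear combinations of the |n>, n an integer. *)
Definition D := {malg C[int]}.
HB.instance Definition _ := GRing.Lmodule.on D.

Definition ket (n : int) : D := << n >>.

Definition opI q s : {linear D -> D} := lin_ext (fun n =>
  ('i * (s * q ^ n - s^-1 * q ^ (- n)) / (q - q^-1)) *: ket n).

Definition opT2 q r s : {linear D -> D} := lin_ext (fun n =>
  (r / (s * q ^ n + s^-1 * q ^ (- n))) *: (ket (n + 1) + ket (n - 1))).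

Definition opT1 q qh r s : {linear D -> D} := lin_ext (fun n =>
  ('i * qh * r / (s * q ^ n + s^-1 * q ^ (- n))) *:
    ((s * q ^ n) *: ket (n + 1) - (s^-1 * q ^ (- n)) *: ket (n - 1))).

Definition Rrs_op q qh r s (x : gen) : {linear D -> D} :=
  match x with
  | genI => opI q s
  | genT1 => opT1 q qh r s
  | genT2 => opT2 q r s
  end.

Lemma lin_ext_ket (f : int -> D) n : lin_ext f (ket n) = f n.
Proof. by rewrite lin_extU scale1r. Qed.

Lemma D_linear0 (f : D -> D) :
  linear f -> (forall n, f (ket n) = 0) -> forall v, f v = 0.
Proof.
move=> flin f0 v.
pose L : {linear D -> D} := HB.pack f (GRing.isLinear.Build C D D *:%R f flin).
rewrite -[f v]/(L v) [v]monalgE linear_sum big1 // => n _.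
have -> : << v@_n *g n >> = v@_n *: ket n :> D.
  by apply/malgP => k; rewrite mcoeffZ !mcoeffU mulrnAr mulr1.
by rewrite linearZ_LR /= f0 scaler0.
Qed.

Lemma D_rel a b c (f g h k e : {linear D -> D}) :
  (forall n, a *: f (g (ket n)) - b *: h (k (ket n)) = c *: e (ket n)) ->
  forall v, a *: f (g v) - b *: h (k v) = c *: e v.
Proof.
move=> H v; apply: subr0_eq.
apply: (D_linear0 (f := fun v => a *: f (g v) - b *: h (k v) - c *: e v)).
  exact: rel_linear.
by move=> n; apply/eqP; rewrite subr_eq0; apply/eqP; apply: H.
Qed.

Lemma admissible_den q s n : q != 0 -> admissible q s ->
  s * q ^ n + s^-1 * q ^ (- n) != 0.
Proof.
move=> q0 [s0 sk]; have [sp sm] := sk (- n).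
have qn0 : q ^ n != 0 by rewrite expfz_neq0.
have -> : s^-1 * q ^ (- n) = (s * q ^ n)^-1 by rewrite invfM invr_expz.
set x := s * q ^ n.
have x0 : x != 0 by rewrite mulf_neq0.
have eqs z : x = z -> s = z * q ^ (- n) by move=> <-; rewrite -invr_expz mulfK.
apply/negP => /eqP /(congr1 ( *%R x)).
rewrite mulr0 mulrDr divff // => xx.
have : x ^+ 2 == 'i ^+ 2 by rewrite sqrCi -subr_eq0 opprK expr2 xx.
rewrite eqf_sqr => /orP[] /eqP /eqs sE; [move: sp | move: sm];
  by rewrite sE ?mulNr eqxx.
Qed.

Lemma generic_q_expz q qh (z : int) : generic_q q qh -> z != 0 -> q ^ z != 1.
Proof.
case=> q0 q1 _; case: z => n n0; first by apply: q1; rewrite lt0n.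
by rewrite NegzE -invr_expz invr_eq1; apply: q1.
Qed.

Lemma generic_q_den q qh : generic_q q qh -> q - q^-1 != 0.
Proof.
case=> q0 q1 _; rewrite subr_eq0; apply/eqP => qq.
by have /negP := q1 2 isT; apply; rewrite expr2 {2}qq divff.
Qed.

Section Relations.
Variables (q qh r s : C).
Hypotheses (hq : generic_q q qh) (hs : admissible q s).

Let X (n : int) := s * q ^ n.

Let q0 : q != 0. Proof. by case: hq. Qed.
Let qh0 : qh != 0.
Proof. by apply: contraNneq q0 => h; case: hq => _ _ <-; rewrite h expr0n. Qed.
Let XV n : s^-1 * q ^ (- n) = (X n)^-1.
Proof. by rewrite /X invfM invr_expz. Qed.
Let X0 n : X n != 0.
Proof. by case: hs => s0 _; rewrite mulf_neq0 ?expfz_neq0. Qed.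
Let den n : X n ^+ 2 + 1 != 0.
Proof.
have := admissible_den n q0 hs; rewrite XV => d.
have -> : X n ^+ 2 + 1 = X n * (X n + (X n)^-1) by field; exact: X0.
by rewrite mulf_neq0.
Qed.
Let Xp n : X (n + 1) = X n * qh ^+ 2.
Proof. by case: hq => _ _ ->; rewrite /X expfzDr // expr1z mulrA. Qed.
Let Xm n : X (n - 1) = X n / qh ^+ 2.
Proof. by case: hq => _ _ ->; rewrite /X expfzDr // mulrA. Qed.
Let denp n : X n ^+ 2 * qh ^+ 4 + 1 != 0.
Proof. by have := den (n + 1); rewrite Xp exprMn -exprM. Qed.
Let denm n : X n ^+ 2 + qh ^+ 4 != 0.
Proof.
have := den (n - 1); rewrite Xm => d.
have -> : X n ^+ 2 + qh ^+ 4 = ((X n / qh ^+ 2) ^+ 2 + 1) * qh ^+ 4.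
  by field; exact: qh0.
by rewrite mulf_neq0 ?expf_neq0.
Qed.
Let dq : qh ^+ 4 - 1 != 0.
Proof.
have := generic_q_den hq; case: hq => _ _ <- d.
have -> : qh ^+ 4 - 1 = (qh ^+ 2 - (qh ^+ 2)^-1) * qh ^+ 2.
  by field; exact: qh0.
by rewrite mulf_neq0 ?expf_neq0.
Qed.

Lemma ket_rels (V : lmodType C) (K : int -> V) (fI f1 f2 : {linear V -> V}) :
  (forall n, fI (K n) = ('i * (X n - (X n)^-1) / (qh ^+ 2 - qh ^- 2)) *: K n) ->
  (forall n, f2 (K n) = (r / (X n + (X n)^-1)) *: (K (n + 1) + K (n - 1))) ->
  (forall n, f1 (K n) = ('i * qh * r / (X n + (X n)^-1)) *:
    (X n *: K (n + 1) - (X n)^-1 *: K (n - 1))) ->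
  forall n,
  [/\ qh *: fI (f2 (K n)) - qh^-1 *: f2 (fI (K n)) = 1 *: f1 (K n),
      qh *: f1 (fI (K n)) - qh^-1 *: fI (f1 (K n)) = 1 *: f2 (K n)
    & qh *: f2 (f1 (K n)) - qh^-1 *: f1 (f2 (K n)) = 0 *: fI (K n)].
Proof.
move=> IE T2E T1E n.
have LZ (f : {linear V -> V}) c v : f (c *: v) = c *: f v by exact: linearZ_LR.
have LD (f : {linear V -> V}) u v : f (u + v) = f u + f v by exact: linearD.
have LB (f : {linear V -> V}) u v : f (u - v) = f u - f v by exact: linearB.
have addK : n + 1 - 1 = n :> int by rewrite addrK.
have subK : n - 1 + 1 = n :> int by rewrite subrK.
have i2 : 'i ^+ 2 = -1 :> C by exact: sqrCi.
have x0 := X0 n; have d := den n; have dp := denp n; have dm := denm n.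
have dq' := dq; have h0 := qh0.
split.
- apply: subr0_eq; rewrite T2E IE T1E !(LZ fI, LZ f2) (LD fI) !IE T2E Xp Xm.
  move: (X n) x0 d dp dm => x x0 d dp dm.
  apply: combine1.
    by field;
      rewrite -?expr2 ?[(x * _) ^+ 2]exprMn -?exprM ?x0 ?d ?dp ?dm ?h0 ?dq'.
  by field; rewrite -?expr2 ?[(x * _) ^+ 2]exprMn -?exprM ?x0 ?d ?dp ?dm ?h0 ?dq'.
- apply: subr0_eq; rewrite IE T1E T2E !(LZ fI, LZ f1) (LB fI) !(LZ fI) !IE T1E Xp Xm.
  move: (X n) x0 d dp dm => x x0 d dp dm.
  apply: combine2.
    by field: i2;
      rewrite -?expr2 ?[(x * _) ^+ 2]exprMn -?exprM ?x0 ?d ?dp ?dm ?h0 ?dq'.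
  by field: i2; rewrite -?expr2 ?[(x * _) ^+ 2]exprMn -?exprM ?x0 ?d ?dp ?dm ?h0 ?dq'.
rewrite scale0r T1E T2E !(LZ f1, LZ f2) (LB f2) (LD f1) !(LZ f2) !T1E !T2E.
rewrite !addK !subK !Xp !Xm; move: (X n) x0 d dp dm => x x0 d dp dm.
apply: combine3.
- by field; rewrite -?expr2 ?[(x * _) ^+ 2]exprMn -?exprM ?x0 ?d ?dp ?dm ?h0 ?dq'.
- by field; rewrite -?expr2 ?[(x * _) ^+ 2]exprMn -?exprM ?x0 ?d ?dp ?dm ?h0 ?dq'.
by field; rewrite -?expr2 ?[(x * _) ^+ 2]exprMn -?exprM ?x0 ?d ?dp ?dm ?h0 ?dq'.
Qed.

Let IE n : opI q s (ket n) =
  ('i * (X n - (X n)^-1) / (qh ^+ 2 - qh ^- 2)) *: ket n.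
Proof. by case: hq => _ _ ->; rewrite [LHS]lin_ext_ket XV. Qed.
Let T2E n : opT2 q r s (ket n) =
  (r / (X n + (X n)^-1)) *: (ket (n + 1) + ket (n - 1)).
Proof. by rewrite [LHS]lin_ext_ket XV. Qed.
Let T1E n : opT1 q qh r s (ket n) =
  ('i * qh * r / (X n + (X n)^-1)) *:
    (X n *: ket (n + 1) - (X n)^-1 *: ket (n - 1)).
Proof. by rewrite [LHS]lin_ext_ket XV. Qed.

Lemma Rrs_rels : op_rels qh (Rrs_op q qh r s).
Proof.
have K := @ket_rels D ket (opI q s) (opT1 q qh r s) (opT2 q r s) IE T2E T1E.
have K1 n := let: And3 k _ _ := K n in k.
have K2 n := let: And3 _ k _ := K n in k.
have K3 n := let: And3 _ _ k := K n in k.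
move=> v; split.
- exact: etrans (D_rel K1 v) (scale1r _).
- exact: etrans (D_rel K2 v) (scale1r _).
exact: etrans (D_rel K3 v) (scale0r _).
Qed.

End Relations.

(* The representation R_{rs}. *)
Definition Rrs q qh r s (hq : generic_q q qh) (hs : admissible q s) :
  representation (Uq qh) D := Uq_rep (Rrs_rels r hq hs).

Lemma Rrs_I q qh r s (hq : generic_q q qh) (hs : admissible q s) n :
  Rrs r hq hs (Uq_gen qh genI) (ket n) =
  ('i * (s * q ^ n - s^-1 * q ^ (- n)) / (q - q^-1)) *: ket n.
Proof. by rewrite Uq_rep_gen [LHS]lin_ext_ket. Qed.

Lemma Rrs_T2 q qh r s (hq : generic_q q qh) (hs : admissible q s) n :
  Rrs r hq hs (Uq_gen qh genT2) (ket n) =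
  (r / (s * q ^ n + s^-1 * q ^ (- n))) *: (ket (n + 1) + ket (n - 1)).
Proof. by rewrite Uq_rep_gen [LHS]lin_ext_ket. Qed.

Lemma Rrs_T1 q qh r s (hq : generic_q q qh) (hs : admissible q s) n :
  Rrs r hq hs (Uq_gen qh genT1) (ket n) =
  ('i * qh * r / (s * q ^ n + s^-1 * q ^ (- n))) *:
    ((s * q ^ n) *: ket (n + 1) - (s^-1 * q ^ (- n)) *: ket (n - 1)).
Proof. by rewrite Uq_rep_gen [LHS]lin_ext_ket. Qed.

Lemma half_integer_admissible q qh s eps (m : int) :
  generic_q q qh -> eps = 1 \/ eps = -1 -> s = eps * 'i * (q ^ m * qh) ->
  admissible q s.
Proof.
move=> hq he ->; have [q0 _ qhE] := hq.
have e1 : eps ^+ 2 = 1 by case: he => ->; rewrite ?sqrrN expr1n.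
have eps0 : eps != 0 by case: he => ->; rewrite ?oppr_eq0 oner_neq0.
have qh0 : qh != 0 by apply: contraNneq q0 => h; rewrite -qhE h expr0n.
split; first by rewrite !mulf_neq0 ?neq0Ci ?expfz_neq0.
move=> k; suff H : (eps * 'i * (q ^ m * qh)) ^+ 2 != ('i * q ^ k) ^+ 2.
  by split; apply: contraNneq H => ->; rewrite ?sqrrN.
rewrite !exprMn e1 mul1r qhE sqrCi (inj_eq (mulfI _)) ?oppr_eq0 ?oner_neq0 //.
have -> : (q ^ m) ^+ 2 * q = q ^ (m + m + 1) by rewrite !expfzDr // expr1z expr2.
have -> : (q ^ k) ^+ 2 = q ^ (k + k) by rewrite expfzDr // expr2.
have z0 : m + m + 1 - (k + k) != 0 by lia.
apply: contraNneq (generic_q_expz hq z0) => h.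
by rewrite expfzDr // h -invr_expz divff // expfz_neq0.
Qed.

End Rrs.

(* Main.v *)
Require Import Defs.
From mathcomp Require Import all_boot all_order all_algebra.
From mathcomp Require Import reals complex.
From mathcomp Require Import ring zify.
From mathcomp.multinomials Require Import monalg.

(** Put x_n = s q^n, and write n' = -2m-1-n for the reflection of Z about the
    half-integer -m-1/2.  The values s = +-i q^(m+1/2) are exactly those with
    s^2 = - q^(2m+1), that is with x_n x_n' = -1 for all n (lemma
    [refl_weight]).  Hence x_n - 1/x_n, and so the eigenvalue of I on |n>, is
    the same at n and at n': the spectrum of I is doubly degenerate.  The
    denominator x_n + 1/x_n of T_1 and T_2 changes sign, which an alternating
    factor repairs: the signed reflection sigma |n> = (-1)^n |n'> commutes with
    I, T_1 and T_2 (lemma [sigma_op]), hence with the whole algebra (lemma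
    [Uq_rep_comm]).

    Since n + n' is odd, sigma squares to -1, so sigma |n> + i |n> belongs to
    the eigenspace of sigma for the eigenvalue i.  As n' <> n, the vectors |n>
    and sigma |n> are linearly independent, so that eigenspace is neither 0 nor
    the whole space; and it is invariant because sigma commutes with the
    representation (lemma [reducible_eigenspace]). *)

Set Implicit Arguments.
Unset Strict Implicit.
Unset Printing Implicit Defensive.

Import Order.TTheory GRing.Theory Num.Theory.
Local Open Scope ring_scope.

Section Intertwiners.
Variables (C : fieldType) (V : lmodType C).

(** The generators act by words and a general element by a linear combination
    of words, so commutation need only be tested on the three generators. *)
Lemma Uq_rep_comm (qh : C) (op : gen -> {linear V -> V}) (opP : op_rels qh op)
    (f : {linear V -> V}) :
  (forall x v, f (op x v) = op x (f v)) ->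
  forall a v, f (Uq_rep opP a v) = Uq_rep opP a (f v).
Proof.
move=> fop a v; set w := qrepr a.
change (f (free_act op w v) = free_act op w (f v)).
rewrite /free_act /lin_ext linear_sum; apply: eq_bigr => u _.
rewrite linearZ_LR /word_act; congr (_ *: _).
by elim: (fmonom_val u) => //= x l <-.
Qed.

(** A non-scalar intertwiner that has an eigenvalue splits off its eigenspace:
    the easy direction of Schur's lemma. *)
Lemma reducible_eigenspace (A : algType C) (rho : representation A V)
    (f : {linear V -> V}) (c : C) (u v : V) :
  (forall a w, f (rho a w) = rho a (f w)) ->
  f u = c *: u -> u != 0 -> f v != c *: v -> reducible rho.
Proof.
move=> fr fu u0 fv; exists (fun w => f w == c *: w); split.
- split=> [|k x y]; rewrite !unfold_in; first by rewrite linear0 scaler0.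
  move=> /eqP fx /eqP fy; rewrite linearP fx fy scalerDr !scalerA.
  by rewrite [c * k]mulrC.
- by exists u => //; rewrite unfold_in fu.
- by exists v; rewrite unfold_in.
by move=> a w; rewrite !unfold_in fr => /eqP ->; rewrite linearZ_LR.
Qed.

End Intertwiners.

Section Reflection.
Variable C : numClosedFieldType.

Lemma D_eq_on_ket (f g : {linear D C -> D C}) :
  (forall n, f (ket C n) = g (ket C n)) -> f =1 g.
Proof.
move=> fg v; apply: subr0_eq; apply: (D_linear0 (f := fun v => f v - g v)).
  by move=> k x y /=; rewrite !linearP addrACA scalerDr.
by move=> n; rewrite fg subrr.
Qed.

Variable m : int.

Definition refl (n : int) : int := - (2 * m + 1) - n.

Definition sigma : {linear D C -> D C} :=
  lin_ext (fun n => (-1) ^ n *: ket C (refl n)).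

Lemma sigma_ket n : sigma (ket C n) = (-1) ^ n *: ket C (refl n).
Proof. exact: lin_ext_ket. Qed.

(** The sign is that of (-1)^(n + refl n) = (-1)^(-2m-1): the half-integer
    centre of the reflection is what makes it -1. *)
Lemma sigma_sqr n : sigma (sigma (ket C n)) = - ket C n.
Proof.
have N1 : -1 != 0 :> C by rewrite oppr_eq0 oner_eq0.
rewrite sigma_ket linearZ_LR /= sigma_ket scalerA -expfzDr //.
have -> : refl (refl n) = n by rewrite /refl; lia.
have -> : n + refl n = Posz 2 * - (m + 1) + 1 by rewrite /refl; lia.
by rewrite expfzDr // -exprz_exp expr1z -exprnP sqrrN expr1n exp1rz mul1r scaleN1r.
Qed.

Lemma refl_neq n : refl n != n.
Proof. by rewrite /refl; lia. Qed.

Variables q qh s eps : C.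
Hypotheses (hq : generic_q q qh) (heps : eps = 1 \/ eps = -1).
Hypothesis hs : s = eps * 'i * (q ^ m * qh).

(** The only place where the special value of s enters. *)
Lemma refl_weight n : s * q ^ refl n = - (s^-1 * q ^ (- n)).
Proof.
have [q0 _ qhE] := hq; have [s0 _] := half_integer_admissible hq heps hs.
have e1 : eps ^+ 2 = 1 by case: heps => ->; rewrite ?sqrrN expr1n.
have s2 : s ^+ 2 = - q ^ (2 * m + 1).
  rewrite hs !exprMn e1 mul1r sqrCi qhE mulN1r expfzDr // expr1z.
  by rewrite [2 * m]mulrC -exprz_exp.
apply: (mulfI s0); rewrite mulrA -expr2 s2 mulrN mulrA divff // mul1r mulNr.
by rewrite -expfzDr //; congr (- (_ ^ _)); rewrite /refl; lia.
Qed.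

Lemma refl_weightV n : s^-1 * q ^ (- refl n) = - (s * q ^ n).
Proof.
have reflK : refl (refl n) = n by rewrite /refl; lia.
by rewrite -[n in RHS]reflK refl_weight opprK.
Qed.

(** T_1 and T_2 map |n> to combinations of |n+1> and |n-1>, where the factor
    (-1)^n of sigma has the opposite sign to that at n; this cancels the sign
    that their denominators take under the reflection.  The coefficients of the
    raising and lowering terms of T_1 are exchanged by the reflection, as the
    two neighbours are. *)
Lemma sigma_op r x v : sigma (Rrs_op q qh r s x v) = Rrs_op q qh r s x (sigma v).
Proof.
have N1 : -1 != 0 :> C by rewrite oppr_eq0 oner_eq0.
have sZ c v' : sigma (c *: v') = c *: sigma v' by exact: linearZ_LR.
have sD u w : sigma (u + w) = sigma u + sigma w by exact: linearD.
have sN u : sigma (- u) = - sigma u by exact: linearN.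
have sp n : (-1) ^ (n + 1) = - (-1) ^ n :> C by rewrite expfzDr // expr1z mulrN1.
have sm n : (-1) ^ (n - 1) = - (-1) ^ n :> C.
  by rewrite -[X in _ = - (_ ^ X)](subrK 1) sp opprK.
have rp n : refl (n + 1) = refl n - 1 by rewrite /refl; lia.
have rm n : refl (n - 1) = refl n + 1 by rewrite /refl; lia.
have E n : Rrs_op q qh r s x (ket C n) = match x with
  | genI => ('i * (s * q ^ n - s^-1 * q ^ (- n)) / (q - q^-1)) *: ket C n
  | genT1 => ('i * qh * r / (s * q ^ n + s^-1 * q ^ (- n))) *:
    ((s * q ^ n) *: ket C (n + 1) - (s^-1 * q ^ (- n)) *: ket C (n - 1))
  | genT2 => (r / (s * q ^ n + s^-1 * q ^ (- n))) *: (ket C (n + 1) + ket C (n - 1))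
  end by case: x => /=; exact: lin_ext_ket.
apply: (D_eq_on_ket (f := sigma \o Rrs_op q qh r s x)
                    (g := Rrs_op q qh r s x \o sigma)) => n /=.
rewrite sigma_ket linearZ_LR /= !E !refl_weight !refl_weightV.
case: x {E} => /=; rewrite !(sZ, sD, sN) !sigma_ket ?rp ?rm ?sp ?sm.
- rewrite !scalerA mulrC; congr (_ * (_ * _ / _) *: _).
  by rewrite opprK addrC.
- move: (ket C _) (ket C _) (s * _) (s^-1 * _) => u w a b.
  rewrite -opprD invrN [b + a]addrC.
  rewrite !(scalerDr, scalerN, scaleNr, scalerA, mulrN, mulNr, opprK) [LHS]addrC.
  by congr (_ *: _ - _ *: _); ring.
rewrite -opprD invrN [_ * q ^ (- n) + _]addrC.
by rewrite !(scalerDr, scalerN, scaleNr, scalerA, mulrN, mulNr) [LHS]addrC [_ * (-1) ^ n]mulrC.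
Qed.

End Reflection.

Theorem proposition8 (R : realType) (q qh r s eps : R[i]) (m : int)
  (hq : generic_q q qh) (hr : r != 0)
  (heps : eps = 1 \/ eps = -1) (hs : s = eps * 'i * (q ^ m * qh)) :
  reducible (Rrs r hq (half_integer_admissible hq heps hs)).
Proof.
have i0 : 'i != 0 :> R[i] by exact: neq0Ci.
(* |0> and sigma |0> have disjoint supports: compare coefficients at 0 *)
have s0 : mcoeff 0 (sigma _ m (ket _ 0)) = 0 :> R[i].
  by rewrite sigma_ket mcoeffZ mcoeffU (negbTE (refl_neq m 0)) mulr0.
have k0 : mcoeff 0 (ket _ 0) = 1 :> R[i] by rewrite mcoeffU eqxx.
apply: (reducible_eigenspace (f := sigma _ m) (c := 'i) (v := ket _ 0)
  (u := sigma _ m (ket _ 0) + 'i *: ket _ 0)).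
- exact: (Uq_rep_comm _ (sigma_op hq heps hs r)).
- by rewrite linearD linearZ_LR /= sigma_sqr scalerDr scalerA -expr2 sqrCi
     scaleN1r addrC.
- apply: contra_neq i0 => /(congr1 (mcoeff 0)).
  by rewrite mcoeffD mcoeffZ mcoeff0 s0 k0 add0r mulr1.
apply: contra_neq i0 => /(congr1 (mcoeff 0)).
by rewrite mcoeffZ s0 k0 mulr1.
Qed.
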